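(* The graph ($1$-skeleton) of the $5$-dimensional cube is strongly $4$-ambiguous: there exist two $4$-polytopes $P$ and $Q$ that are not combinatorially equivalent to each other and whose $1$-skeleta are both combinatorially equivalent to the $1$-skeleton of the $5$-cube.
   Context: The $k$-skeleton of a convex polytope is the polytopal complex formed by its faces of dimension at most $k$. Two polytopes or complexes are combinatorially equivalent if their face posets are isomorphic. Let $\mathcal S$ be the common $k$-skeleton (up to combinatorial equivalence) of a $d$-polytope $P$ and a $d'$-polytope $P'$ with $d<d'$. Then $\mathcal S$ is called strongly $d$-ambiguous if there is another $d$-polytope $Q$, not combinatorially equivalent to $P$, whose $k$-skeleton is also combinatorially equivalent to $\mathcal S$. *)

(* Defs.v *)
From mathcomp Require Import all_boot all_order all_algebra.
From mathcomp Require Import all_classical all_reals.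
From mathcomp Require Import convex.

Set Implicit Arguments.
Unset Strict Implicit.
Unset Printing Implicit Defensive.

Import Order.TTheory GRing.Theory Num.Theory.

Local Open Scope classical_set_scope.
Local Open Scope ring_scope.

Section Polytopes.
Context {R : realType}.

Definition conv_hull n (V : set 'rV[R]_n) : set 'rV[R]_n :=
  smallest (@convex_set R 'rV[R]_n) V.

(* In characteristic 0, closure under lines gives closure under all affine
   combinations.  The empty set is affine. *)
Definition affine_set n (A : set 'rV[R]_n) : Prop :=
  forall x y (t : R), A x -> A y -> A ((1 - t) *: x + t *: y).

Definition affine_hull n (S : set 'rV[R]_n) : set 'rV[R]_n :=
  smallest (@affine_set n) S.

(* Never holds for S = set0, whose dimension is -1 by convention. *)
Definition has_dim n (S : set 'rV[R]_n) (k : nat) : Prop :=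
  exists (x0 : 'rV[R]_n) (U : {vspace 'rV[R]_n}),
    \dim U = k /\ affine_hull S = [set x | x - x0 \in U].

(* The ambient dimension n is unrelated to d. *)
Definition dpolytope (d n : nat) (P : set 'rV[R]_n) : Prop :=
  (exists2 V : set 'rV[R]_n, finite_set V & P = conv_hull V) /\ has_dim P d.

(* The sets P :&: {x | x c = b} with x c <= b valid on P.  Since c = 0 is
   allowed, both P itself (b = 0) and the empty face (b = 1) are included. *)
Definition face n (P F : set 'rV[R]_n) : Prop :=
  exists (c : 'cV[R]_n) (b : R),
    (forall x, P x -> (x *m c) 0 0 <= b) /\
    F = P `&` [set x | (x *m c) 0 0 = b].

Definition faces n (P : set 'rV[R]_n) : set (set 'rV[R]_n) :=
  [set F | face P F].

Definition skeleton (k n : nat) (P : set 'rV[R]_n) : set (set 'rV[R]_n) :=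
  [set F | face P F /\
           (F = set0 \/ exists2 j : nat, (j <= k)%N & has_dim F j)].

(* Isomorphism of families of sets ordered by inclusion, used for the full
   face lattice of a polytope as well as for polytopal complexes. *)
Definition comb_equiv m n (A : set (set 'rV[R]_m)) (B : set (set 'rV[R]_n)) :
    Prop :=
  exists f : set 'rV[R]_m -> set 'rV[R]_n,
    set_bij A B f /\
    (forall F G, A F -> A G -> (F `<=` G <-> f F `<=` f G)).

Definition strongly_ambiguous (k d n : nat) (S : set (set 'rV[R]_n)) : Prop :=
  exists (d' n' p q : nat)
         (P' : set 'rV[R]_n') (P : set 'rV[R]_p) (Q : set 'rV[R]_q),
    [/\ (d < d')%N, dpolytope d' P', dpolytope d P & dpolytope d Q] /\
    [/\ comb_equiv (skeleton k P') S, comb_equiv (skeleton k P) S,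
        comb_equiv (skeleton k Q) S & ~ comb_equiv (faces P) (faces Q)].

End Polytopes.

Definition cube (R : realType) (n : nat) : set 'rV[R]_n :=
  [set x | forall i, 0 <= x 0 i <= 1].

Arguments cube R n : clear implicits.

(* Main.v *)
Require Import Defs.
From mathcomp Require Import all_boot all_order all_algebra.
From mathcomp Require Import all_classical all_reals.
From mathcomp Require Import convex interval_inference lra.

(** The faces of the hull of finitely many points correspond to the sets of
    points on which some valid linear inequality is tight, and when every point
    is a vertex, the 1-skeleton corresponds to the tight sets with at most two
    elements.

    The first polytope is the hull of the points (+-2,+-2,+-1,+-1) and
    (+-1,+-1,+-2,+-2); its 24 facets are combinatorial 3-cubes.  Four of them are
    the products of a side of the square [-2,2]^2 with the square [-1,1]^2.
    In the second polytope the first square is replaced by a triangle with one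
    extra vertex in the middle of a side, and two adjacent cubes among these
    four merge into a single facet with 12 vertices.  The common square of the
    two cubes disappears but its edges survive, since the square over the extra
    vertex is slightly enlarged and bulges out of the merged facet; so the graph
    is still that of the 5-cube.

    In the first polytope every proper face has at most 8 vertices: the 32
    vertices split into 8 classes of 4, and a valid inequality which is tight at
    two vertices of one class is tight everywhere. *)

Set Implicit Arguments.
Unset Strict Implicit.
Unset Printing Implicit Defensive.

Import Order.TTheory GRing.Theory Num.Theory.

Local Open Scope classical_set_scope.
Local Open Scope ring_scope.

(** * Convex and affine hulls *)

Section ConvexHulls.
Context {R : realType} {n : nat}.
Implicit Types (S A : set 'rV[R]_n) (x y : 'rV[R]_n) (c : 'cV[R]_n).

Lemma convex_setP A : @convex_set R 'rV[R]_n A <->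
  forall x y (t : R), 0 <= t <= 1 -> A x -> A y -> A (t *: x + (1 - t) *: y).
Proof.
split=> [cA x y t /andP[t0 t1] Ax Ay|cA x y t].
  have t01 : Itv.spec (@Itv.num_sem R) (Itv.Real `[0%Z, 1%Z]) t.
    by rewrite /= /Itv.num_sem /= num_real in_itv /= t0 t1.
  have := cA x y (Itv.mk t01).
  by rewrite !inE; apply.
rewrite !inE => Ax Ay; apply: cA => //.
by rewrite ge0 le1.
Qed.

Lemma convex_conv_hull S : @convex_set R 'rV[R]_n (conv_hull S).
Proof.
apply/convex_setP => x y t t01 Sx Sy A [cA SA].
by move/convex_setP: (cA); apply=> //; [exact: Sx|exact: Sy].
Qed.

Lemma conv_hull_set0 : conv_hull set0 = set0 :> set 'rV[R]_n.
Proof. by apply: smallest_id; apply/convex_setP. Qed.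

Lemma conv_hull_set1 x : conv_hull [set x] = [set x].
Proof.
apply: smallest_id; apply/convex_setP => _ _ t _ -> ->.
by rewrite /= -scalerDl addrC subrK scale1r.
Qed.

Definition dotp c x : R := (x *m c) 0 0.

Lemma dotpD c x y : dotp c (x + y) = dotp c x + dotp c y.
Proof. by rewrite /dotp mulmxDl mxE. Qed.

Lemma dotpZ c (t : R) x : dotp c (t *: x) = t * dotp c x.
Proof. by rewrite /dotp -scalemxAl mxE. Qed.

(** The midpoint of [x + y] and [x + z], moved twice as far away from [x]. *)
Lemma affine_setD A x y z : affine_set A -> A x -> A (x + y) -> A (x + z) ->
  A (x + (y + z)).
Proof.
move=> affA Ax Ay Az.
have Am := affA _ _ 2^-1 Ay Az.
have := affA _ _ 2 Ax Am.
rewrite !scalerDr; congr A; apply/rowP => j; rewrite !mxE.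
lra.
Qed.

Lemma affine_setZ A x y (t : R) : affine_set A -> A x -> A (x + y) ->
  A (x + t *: y).
Proof.
move=> affA Ax Ay; have := affA _ _ t Ax Ay.
by congr A; apply/rowP => j; rewrite !mxE; lra.
Qed.

Lemma has_dim_full S x0 :
  S x0 -> (forall i, exists2 k : R, k != 0 & S (x0 + k *: delta_mx 0 i)) ->
  has_dim S n.
Proof.
move=> Sx0 Sx0i; exists 0, fullv; split.
  by rewrite dimvf /dim /= mul1n.
apply/seteqP; split=> [x _|x _ A [affA SA]]; first by rewrite /= memvf.
rewrite -(subrKC x0 x) [x - x0]row_sum_delta.
elim/big_ind: _ => [|y z Ay Az|i _].
- by rewrite addr0; exact: SA.
- by apply: affine_setD => //; exact: SA.
have [k k0 /SA Ak] := Sx0i i.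
rewrite -(mulfVK k0 ((x - x0) 0 i)) -scalerA.
by apply: affine_setZ => //; exact: SA.
Qed.

End ConvexHulls.

(** * Faces of the hull of a finite family *)

Section Faces.
Context {R : realType} {T : finType} {n : nat}.
Variable V : T -> 'rV[R]_n.
Implicit Types (S : {set T}) (u v w : T) (c : 'cV[R]_n) (b : R).

Definition hull S : set 'rV[R]_n := conv_hull (V @` [set` S]).

Definition valid c b : Prop := forall u, dotp c (V u) <= b.

Definition tight c b : {set T} := [set u | dotp c (V u) == b]%SET.

Definition supported S : Prop := exists c b, valid c b /\ S = tight c b.

Definition vset (F : set 'rV[R]_n) : {set T} := [set u | `[< F (V u) >]]%SET.

Lemma vsetP F u : reflect (F (V u)) (u \in vset F).
Proof. by rewrite finset.in_set; exact: asboolP. Qed.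

Lemma hull_vertex S u : u \in S -> hull S (V u).
Proof. by move=> uS; apply: sub_gen_smallest; exists u. Qed.

Lemma hullS S S' : S \subset S' -> hull S `<=` hull S'.
Proof.
move=> /fintype.subsetP sSS'.
apply: smallest_sub; first exact: convex_conv_hull.
by move=> _ [u uS <-]; have /(_ (sSS' u uS)) := @hull_vertex S' u.
Qed.

Lemma dotp_hull_le S c b x :
  (forall u, u \in S -> dotp c (V u) <= b) -> hull S x -> dotp c x <= b.
Proof.
move=> Sb; apply: (smallest_sub (X := [set x | dotp c x <= b])).
  apply/convex_setP => y z t /andP[t0 t1] /= yb zb.
  by rewrite dotpD !dotpZ; nra.
by move=> _ [u uS <-]; exact: Sb.
Qed.

Lemma dotp_hull_eq S c b x :
  (forall u, u \in S -> dotp c (V u) = b) -> hull S x -> dotp c x = b.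
Proof.
move=> Sb; apply: (smallest_sub (X := [set x | dotp c x = b])).
  apply/convex_setP => y z t _ /= yb zb.
  by rewrite dotpD !dotpZ yb zb -mulrDl addrC subrK mul1r.
by move=> _ [u uS <-]; exact: Sb.
Qed.

(* The points of the polytope below the supporting hyperplane, together with
   the hull of the tight vertices, form a convex set. *)
Lemma face_hull c b : valid c b ->
  hull [set: T] `&` [set x | dotp c x = b] = hull (tight c b).
Proof.
move=> vcb; apply/seteqP; split=> [x [Px xb]|x Fx]; last first.
  split; first by apply: hullS Fx; apply/fintype.subsetP => u; rewrite inE.
  by apply: dotp_hull_eq Fx => u; rewrite inE => /eqP.
suff: [set x | dotp c x < b] x \/ hull (tight c b) x.
  by case=> //=; rewrite xb ltxx.
move: x Px {xb}; apply: smallest_sub => [|_ [u _ <-]]; last first.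
  have := vcb u; rewrite le_eqVlt => /predU1P[ub|]; last by left.
  by right; apply: hull_vertex; rewrite inE ub.
apply/convex_setP => y z t t01 Hy Hz.
have [->|t0] := eqVneq t 0; first by rewrite scale0r add0r subr0 scale1r.
have [->|t1] := eqVneq t 1; first by rewrite subrr scale0r addr0 scale1r.
have {t0}t0 : 0 < t by rewrite lt_def t0; case/andP: t01.
have {t1}t1 : 0 < 1 - t by rewrite subr_gt0 lt_def eq_sym t1; case/andP: t01.
have le_b x : [set x | dotp c x < b] x \/ hull (tight c b) x -> dotp c x <= b.
  case=> [/ltW//|]; apply: dotp_hull_le => u.
  by rewrite inE => /eqP->.
have yb := le_b _ Hy; have zb := le_b _ Hz.
case: Hy => /= [yb'|Hy]; first by left=> /=; rewrite dotpD !dotpZ; nra.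
case: Hz => /= [zb'|Hz]; first by left=> /=; rewrite dotpD !dotpZ; nra.
right; have /convex_setP := @convex_conv_hull _ _ (V @` [set` tight c b]).
exact.
Qed.

Lemma faceP F : face (hull [set: T]) F <-> exists2 S, supported S & F = hull S.
Proof.
split=> [[c [b [vP ->]]]|[S [c [b [vcb ->]]] ->]].
  have vcb : valid c b by move=> u; apply: vP; exact: hull_vertex.
  by exists (tight c b); [exists c, b|exact: face_hull].
exists c, b; split; last by rewrite -face_hull.
by move=> x; apply: dotp_hull_le => u _; exact: vcb.
Qed.

Lemma vset_hull S : supported S -> vset (hull S) = S.
Proof.
move=> [c [b [vcb ->]]]; apply/setP => u.
apply/vsetP/idP; last exact: hull_vertex.
by rewrite -face_hull// => -[_ /= ub]; rewrite inE ub.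
Qed.

Lemma hull_sub S S' : supported S' -> hull S `<=` hull S' <-> S \subset S'.
Proof.
move=> supS'; split=> [SS'|]; last exact: hullS.
apply/fintype.subsetP => u uS; rewrite -(vset_hull supS').
by apply/vsetP; apply: SS'; exact: hull_vertex.
Qed.

Lemma supported0 : supported finset.set0.
Proof.
exists 0, 1; have d0 u : dotp 0 (V u) = 0 by rewrite /dotp mulmx0 mxE.
split=> [u|]; first by rewrite d0 ler01.
by apply/setP => u; rewrite !inE d0 eq_sym oner_eq0.
Qed.

Lemma supportedT : supported [set: T].
Proof.
exists 0, 0; have d0 u : dotp 0 (V u) = 0 by rewrite /dotp mulmx0 mxE.
split=> [u|]; first by rewrite d0.
by apply/setP => u; rewrite !inE d0 eqxx.
Qed.

Lemma hull0 : hull finset.set0 = set0.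
Proof.
rewrite -[RHS]conv_hull_set0; congr conv_hull.
by apply/seteqP; split=> [_ [u /= + _]|//]; rewrite inE.
Qed.

Lemma hull1 u : hull [set u]%SET = [set V u].
Proof.
rewrite -[RHS]conv_hull_set1; congr conv_hull.
apply/seteqP; split=> [_ [v /= + <-]|_ ->]; first by rewrite inE => /eqP->.
by exists u => //=; rewrite inE.
Qed.

Hypothesis vertexV : forall u, supported [set u]%SET.

Lemma vertex_inj : injective V.
Proof.
move=> u v uv; have := vset_hull (vertexV v); rewrite hull1 => /setP/(_ u).
by rewrite !inE uv => /esym; rewrite asboolT// => /eqP.
Qed.

Lemma has_dim_point u : has_dim [set V u] 0.
Proof.
exists (V u), 0%VS; split; first by rewrite dimv0.
apply/seteqP; split=> [|x /= xu].
  apply: smallest_sub => [x y t|x ->] /=; rewrite !memv0 ?subrr//.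
  rewrite !subr_eq0 => /eqP-> /eqP->.
  by rewrite -scalerDl subrK scale1r.
apply: sub_gen_smallest => /=.
by move: xu; rewrite memv0 subr_eq0 => /eqP.
Qed.

Lemma has_dim_segment u v : u != v -> has_dim (hull [set u; v]%SET) 1.
Proof.
move=> uv; exists (V u), <[V v - V u]>%VS; split.
  by rewrite dim_vline subr_eq0 (inj_eq vertex_inj) eq_sym uv.
have affL : affine_set [set x | x - V u \in <[V v - V u]>%VS].
  move=> x y t /= xL yL.
  suff -> : (1 - t) *: x + t *: y - V u = (1 - t) *: (x - V u) + t *: (y - V u).
    by rewrite rpredD ?rpredZ.
  by apply/rowP => j; rewrite !mxE; lra.
apply/seteqP; split.
  apply: smallest_sub => //; apply: smallest_sub.
    apply/convex_setP => x y t _ xL yL.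
    by rewrite [t *: x + _]addrC; exact: affL.
  move=> _ [w /= + <-]; rewrite !inE => /orP[]/eqP->.
    by rewrite subrr mem0v.
  by rewrite memv_line.
move=> x /= /vlineP[t xt] A [affA SA].
have Au : A (V u) by apply: SA; apply: hull_vertex; rewrite !inE eqxx.
have Av : A (V v) by apply: SA; apply: hull_vertex; rewrite !inE eqxx orbT.
have := affA _ _ t Au Av; congr A.
by rewrite -[RHS](subrK (V u)) xt; apply/rowP => j; rewrite !mxE; lra.
Qed.

(** An inequality tight at [v] alone is monotone along the line, so at one of the two outer points
    it would reach the bound as well. *)
Lemma vertex_not_between (x0 d : 'rV[R]_n) (s t r : R) u v w :
  u != v -> w != v -> V u = x0 + s *: d -> V v = x0 + t *: d ->
  V w = x0 + r *: d -> s <= t -> t <= r -> False.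
Proof.
move=> uv wv Vu Vv Vw st tr.
have [c [b [vcb vE]]] := vertexV v.
have lt_b z : z != v -> dotp c (V z) < b.
  move=> zv; rewrite lt_def vcb andbT eq_sym.
  by move/setP/(_ z): vE; rewrite !inE (negbTE zv) => <-.
have := lt_b _ uv; have := lt_b _ wv.
have: dotp c (V v) = b by move/setP/(_ v): vE; rewrite !inE eqxx => /esym/eqP.
rewrite Vu Vv Vw !dotpD !dotpZ => vb wb ub.
have [d0|/ltW d0] := leP 0 (dotp c d).
  by have := ler_wpM2r d0 tr; lra.
by have := ler_wnM2r d0 st; lra.
Qed.

(** Three vertices in a hull of dimension at most 1 would be collinear, and [vertex_not_between]
    excludes the middle one. *)
Lemma has_dim_le1_card S j : (j <= 1)%N -> has_dim (hull S) j -> (#|S| <= 2)%N.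
Proof.
move=> j1 [x0 [U [dimU affS]]]; rewrite leqNgt; apply/negP => /card_gt2P.
move=> [u [v [w [[uS vS wS] [uv vw wu]]]]].
have [d Ud] : exists d, forall x, x \in U -> exists k : R, x = k *: d.
  (* Only the index 0 can occur, because [\dim U <= 1]; in dimension 0 the default value of [nth] is
     the zero vector. *)
  exists (vbasis U)`_0 => x /coord_vbasis ->.
  exists (\sum_i coord (vbasis U) i x); rewrite scaler_suml.
  apply: eq_bigr => i _; congr (_ *: _`_ _); apply/eqP.
  by rewrite -leqn0 -ltnS (leq_trans (ltn_ord i))// dimU.
have SU z : z \in S -> exists k : R, V z = x0 + k *: d.
  move=> zS; have /Ud[k zk] : V z - x0 \in U.
    suff: [set x | x - x0 \in U] (V z) by [].
    by rewrite -affS; apply: sub_gen_smallest; exact: hull_vertex.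
  by exists k; rewrite -zk subrKC.
have [s Vu] := SU _ uS; have [t Vv] := SU _ vS; have [r Vw] := SU _ wS.
have between := @vertex_not_between x0 d.
have [vu wv uw] : [/\ v != u, w != v & u != w].
  by rewrite eq_sym uv eq_sym vw eq_sym wu.
have [st|/ltW ts] := leP s t; have [tr|/ltW rt] := leP t r;
  have [sr|/ltW rs] := leP s r;
  first [by apply: (between s t r u v w)|by apply: (between r t s w v u)
        |by apply: (between t s r v u w)|by apply: (between r s t w u v)
        |by apply: (between s r t u w v)|by apply: (between t r s v w u)].
Qed.

End Faces.

(** * Skeleta and combinatorial equivalence *)

Lemma card_le2_cases (T : finType) (S : {set T}) : (#|S| <= 2)%N ->
  [\/ S = finset.set0, exists u, S = [set u]%SET
    | exists u v, u != v /\ S = [set u; v]%SET].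
Proof.
rewrite leq_eqVlt => /predU1P[/eqP/cards2P[u [v [uv ->]]]|].
  by constructor 3; exists u, v.
rewrite ltnS leq_eqVlt => /predU1P[/eqP/cards1P[u ->]|].
  by constructor 2; exists u.
by rewrite ltnS leqn0 cards_eq0 => /eqP ->; constructor 1.
Qed.

Section Graph.
Context {R : realType} {T : finType} (adj : rel T).
Implicit Types (S : {set T}).

(** The case [u = v] of the first clause makes every point a vertex. By the second clause a face
    containing two nonadjacent vertices has a third one, so it is not an edge. *)
Definition has_graph n (V : T -> 'rV[R]_n) : Prop :=
  (forall u v, (u == v) || adj u v -> supported V [set u; v]%SET) /\
  (forall u v (S : {set T}), supported V S -> u \in S -> v \in S ->
    u != v -> ~~ adj u v -> (2 < #|S|)%N).

Definition clique (S : {set T}) : Prop :=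
  forall u v, u \in S -> v \in S -> (u == v) || adj u v.

Lemma has_graph_vertex n (V : T -> 'rV[R]_n) :
  has_graph V -> forall u, supported V [set u]%SET.
Proof.
move=> [sup _] u; rewrite -[[set u]%SET]finset.setUid.
by apply: sup; rewrite eqxx.
Qed.

Lemma has_graph_clique n (V : T -> 'rV[R]_n) S : has_graph V ->
  (#|S| <= 2)%N -> supported V S <-> clique S.
Proof.
move=> [sup nsup] S2; split=> [supS u v uS vS|cS].
  apply: contraTT S2; rewrite negb_or -ltnNge => /andP[uv nuv].
  exact: nsup supS uS vS uv nuv.
have [S0|[u Su]|[u [v [_ Suv]]]] := card_le2_cases S2.
- by rewrite S0; exact: supported0.
- by rewrite Su -[[set u]%SET]finset.setUid; apply: sup; rewrite eqxx.
- rewrite Suv; apply: sup; apply: cS; rewrite Suv !inE eqxx ?orbT//.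
Qed.

Lemma skeleton1P n (V : T -> 'rV[R]_n) : has_graph V ->
  skeleton 1 (hull V [set: T]) =
    [set hull V S | S in [set S : {set T} | (#|S| <= 2)%N /\ clique S]].
Proof.
move=> gV; have vV := has_graph_vertex gV.
apply/seteqP; split=> [F [/faceP[S supS ->] dimS]|_ [S [S2 cS] <-]].
  exists S => //=.
  have S2 : (#|S| <= 2)%N.
    case: dimS => [S0|[j j1 /(has_dim_le1_card vV j1)//]].
    rewrite -(vset_hull supS) S0 (_ : vset V set0 = finset.set0) ?cards0//.
    by apply/setP => u; rewrite finset.in_set0; apply/negP => /vsetP.
  by split=> //; exact: (has_graph_clique gV S2).1.
have supS := (has_graph_clique gV S2).2 cS.
split; first by apply/faceP; exists S.
have [->|[u ->]|[u [v [uv ->]]]] := card_le2_cases S2.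
- by left; exact: hull0.
- by right; exists 0%N => //; rewrite hull1; exact: has_dim_point.
- by right; exists 1%N => //; exact: has_dim_segment.
Qed.

(** By [skeleton1P] both skeleta are indexed by the cliques with at most two elements, which depend
    on [adj] only. *)
Lemma comb_equiv_skeleton1 m n (V : T -> 'rV[R]_m) (W : T -> 'rV[R]_n) :
  has_graph V -> has_graph W ->
  comb_equiv (skeleton 1 (hull V [set: T])) (skeleton 1 (hull W [set: T])).
Proof.
move=> gV gW; rewrite (skeleton1P gV) (skeleton1P gW).
have supV S : (#|S| <= 2)%N /\ clique S -> supported V S.
  by case=> S2 cS; exact: (has_graph_clique gV S2).2.
have supW S : (#|S| <= 2)%N /\ clique S -> supported W S.
  by case=> S2 cS; exact: (has_graph_clique gW S2).2.
exists (fun F => hull W (vset V F)); split.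
  split=> [_ [S smS <-] /=|F G|_ [S smS <-]].
  - by rewrite vset_hull; [exists S|exact: supV].
  - rewrite !inE => -[S smS <-] [S' smS' <-].
    rewrite !(vset_hull (supV _ _))// => /(congr1 (vset W)).
    by rewrite !(vset_hull (supW _ _))// => ->.
  exists (hull V S); first by exists S.
  by rewrite vset_hull//; exact: supV.
move=> _ _ [S smS <-] [S' smS' <-].
rewrite !(vset_hull (supV _ _))//.
have := hull_sub S (supV _ smS'); have := hull_sub S (supW _ smS').
by case=> WSS' SS'W [VSS' SS'V]; split=> [/VSS'/SS'W|/WSS'/SS'V].
Qed.

End Graph.

Section ProperFaces.
Context {R : realType} {T T' : finType} {m n : nat}.
Variables (V : T -> 'rV[R]_m) (W : T' -> 'rV[R]_n).
Hypothesis vertexV : forall u, supported V [set u]%SET.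
Hypothesis vertexW : forall u, supported W [set u]%SET.

(** An isomorphism of face lattices preserves the least and the greatest face, hence also the atoms,
    which are the vertices; so the vertices of a face inject into those of its image. *)
Lemma comb_equiv_proper_face S :
  comb_equiv (faces (hull V [set: T])) (faces (hull W [set: T'])) ->
  supported V S -> S != [set: T]%SET ->
  exists S', [/\ supported W S', S' != [set: T']%SET & (#|S| <= #|S'|)%N].
Proof.
move=> [f [[fF f_inj f_surj] f_le]] supS ST.
have faceV A : supported V A -> faces (hull V [set: T]) (hull V A).
  by move=> supA; apply/faceP; exists A.
have faceW A : supported W A -> faces (hull W [set: T']) (hull W A).
  by move=> supA; apply/faceP; exists A.
have inj F G : faces (hull V [set: T]) F -> faces (hull V [set: T]) G ->
    f F = f G -> F = G by move=> fF' fG'; apply: f_inj; rewrite inE.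
have vface u : faces (hull V [set: T]) [set V u].
  by rewrite -hull1; exact: faceV.
have face0 : faces (hull V [set: T]) set0.
  by rewrite -(hull0 V); apply: faceV; exact: supported0.
have f0 : f set0 = set0.
  have /f_surj[G fG G0] : faces (hull W [set: T']) set0.
    by rewrite -(hull0 W); apply: faceW; exact: supported0.
  by apply/seteqP; split=> //; rewrite -[X in _ `<=` X]G0; apply/f_le.
have fT : f (hull V [set: T]) = hull W [set: T'].
  have fVT := faceV _ (supportedT V).
  have /f_surj[G fG GT] := faceW _ (supportedT W).
  apply/seteqP; split.
    by have /faceP[A _ ->] := fF _ fVT; apply: hullS; exact: finset.subsetT.
  rewrite -GT; apply/f_le => //.
  by have /faceP[A _ ->] := fG; apply: hullS; exact: finset.subsetT.
have fS := faceV _ supS.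
have /faceP[S' supS' fSE] := fF _ fS.
exists S'; split=> //.
  apply: contra_neq ST => S'T; rewrite S'T -fT in fSE.
  move/inj: fSE => /(_ fS (faceV _ (supportedT V))) /(congr1 (vset V)).
  by rewrite !vset_hull//; exact: supportedT.
(* The preimage of a vertex [W w] of the image lies in [[set V u]], and it is nonempty because [f]
   sends the empty face to the empty face. *)
have atom u : exists w, f [set V u] = [set W w].
  have /faceP[A supA fA] := fF _ (vface u).
  have [A0|/set0Pn[w wA]] := eqVneq A finset.set0.
    have /inj : f [set V u] = f set0 by rewrite fA A0 hull0 f0.
    by move=> /(_ (vface u) face0) /seteqP[/(_ (V u) erefl)].
  have /f_surj[G fG Gw] : faces (hull W [set: T']) [set W w].
    by rewrite -hull1; apply: faceW; exact: vertexW.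
  exists w; rewrite -Gw; congr f; apply/esym.
  have : G `<=` [set V u].
    apply/f_le => //; rewrite Gw fA => _ ->; exact: hull_vertex.
  move=> /subset_set1[G0|//].
  by move: Gw; rewrite G0 f0 => /seteqP[_ /(_ _ erefl)].
have [g gE] := choice atom.
have g_inj : injective g.
  move=> u v guv; have /inj : f [set V u] = f [set V v] by rewrite !gE guv.
  move=> /(_ (vface u) (vface v)) /seteqP[/(_ _ erefl) /= Vuv _].
  exact: vertex_inj Vuv.
rewrite -(card_imset (mem S) g_inj); apply/subset_leq_card/fintype.subsetP.
move=> _ /imsetP[u uS ->].
have Vu : f [set V u] `<=` f (hull V S).
  by apply/f_le => // _ ->; exact: hull_vertex.
rewrite -(vset_hull supS') -fSE; apply/vsetP; apply: Vu.
by rewrite gE.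
Qed.

End ProperFaces.

(** * Integer certificates *)

Definition vtx : Type := bool * bool * bool * bool * bool.

Definition vertices : seq vtx :=
  let B := [:: false; true] in
  [seq (x, e) | x <- [seq (x, d) | x <- [seq (x, c) | x <-
    [seq (a, b) | a <- B, b <- B], c <- B], d <- B], e <- B].

Lemma mem_vertices u : u \in vertices.
Proof. by move: u => [[[[[] []] []] []] []]. Qed.

Lemma all_vertices (a : pred vtx) : all a vertices -> forall u, a u.
Proof. by move=> /allP au u; apply: au; exact: mem_vertices. Qed.

Definition cube_dist (u v : vtx) : nat :=
  let: (a, b, c, d, e) := u in let: (a', b', c', d', e') := v in
  ((a != a') + (b != b') + (c != c') + (d != d') + (e != e'))%N.

Definition cube_adj : rel vtx := fun u v => cube_dist u v == 1.

Lemma cube_dist_le1 u v : (cube_dist u v <= 1)%N = (u == v) || cube_adj u v.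
Proof.
by move: u v => [[[[[] []] []] []] []] [[[[[] []] []] []] []].
Qed.

Section Certificates.
Variables (n : nat) (p : vtx -> seq int).

(* In homogeneous coordinates the inequality 0 <= h0 + h1 x1 + ... + hn xn
   is the list [:: h0; h1; ...; hn]. *)
Definition hom u : seq int := 1 :: p u.

Definition dotz (h x : seq int) : int :=
  foldr (fun j s => h`_j * x`_j + s) 0 (iota 0 n.+1).

Definition coef (l : seq (nat * vtx)) (j : nat) : int :=
  foldr (fun kx s => kx.1%:Z * (hom kx.2)`_j + s) 0 l.

(** Index 0 compares the total weights, so this is an affine dependence with natural numbers as
    weights. *)
Definition balanced (l r : seq (nat * vtx)) : bool :=
  all (fun j => coef l j == coef r j) (iota 0 n.+1).

(** A sum of valid inequalities is tight exactly where all summands are; the facets through an edge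
    thus combine into an inequality tight at its two ends only. *)
Definition facet_sum (facets : seq (seq int)) (u v : vtx) : seq int :=
  let tight_facets := [seq h <- facets |
    (dotz h (hom u) == 0) && (dotz h (hom v) == 0)] in
  mkseq (fun j => foldr (fun h s => h`_j + s) 0 tight_facets) n.+1.

Definition edges_check (facets : seq (seq int)) : bool :=
  all (fun u => all (fun v =>
    if (cube_dist u v <= 1)%N then
      let h := facet_sum facets u v in
      all (fun w => let s := dotz h (hom w) in
        (0 <= s) && ((s == 0) == ((w == u) || (w == v)))) vertices
    else true) vertices) vertices.

Definition within (u v : vtx) (l : seq (nat * vtx)) : bool :=
  all (fun kx => (kx.2 == u) || (kx.2 == v)) l.

(* The conditionals keep vm_compute, which evaluates both arguments of a
   boolean operation, from computing the expensive branch. *)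
Definition third_vertex u v (lr : seq (nat * vtx) * seq (nat * vtx)) : bool :=
  if within u v lr.1 then
    has (fun kx => (0 < kx.1)%N && ~~ ((kx.2 == u) || (kx.2 == v))) lr.2 &&
    balanced lr.1 lr.2
  else false.

Definition all_positive u v (lr : seq (nat * vtx) * seq (nat * vtx)) : bool :=
  if within u v lr.1 then
    all (fun w => has (fun kx => (0 < kx.1)%N && (kx.2 == w)) lr.2) vertices &&
    balanced lr.1 lr.2
  else false.

Definition nonedges_check
    (deps : vtx -> vtx -> seq (seq (nat * vtx) * seq (nat * vtx))) : bool :=
  all (fun u => all (fun v =>
    if (cube_dist u v <= 1)%N then true
    else has (third_vertex u v) (deps u v)) vertices) vertices.

Definition far_check (cls : vtx -> bool * bool * bool)
    (deps : vtx -> vtx -> seq (seq (nat * vtx) * seq (nat * vtx))) : bool :=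
  all (fun u => all (fun v =>
    if (u != v) && (cls u == cls v) then has (all_positive u v) (deps u v)
    else true) vertices) vertices.

(** Provides the unit directions at one vertex that [has_dim_full] asks for. *)
Definition axes_check : bool :=
  has (fun u => all (fun j => has (fun v =>
    ((p v)`_j != (p u)`_j) &&
    all (fun i => (i == j) || ((p v)`_i == (p u)`_i)) (iota 0 n))
    vertices) (iota 0 n)) vertices.

Context {R : realType}.

Definition int_point u : 'rV[R]_n := \row_j ((p u)`_j)%:~R.

Definition slack (c : 'cV[R]_n) (b : R) u : R := b - dotp c (int_point u).

(** The slack is a linear form in [hom u] with coefficients [b] and [- c], so dependences between
    homogenized points carry over to slacks. *)
Lemma slackE c b u :
  slack c b u = \sum_(j < n.+1) ((hom u)`_j)%:~R *
    (if unlift ord0 j is Some i then - c i 0 else b).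
Proof.
rewrite big_ord_recl unlift_none /= mul1r; congr (_ + _).
rewrite /dotp mxE -sumrN; apply: eq_bigr => j _.
by rewrite liftK mxE mulrN.
Qed.

Lemma supported_cert (h : seq int) (S : {set vtx}) :
  (forall w, 0 <= dotz h (hom w) /\ (dotz h (hom w) == 0) = (w \in S)) ->
  supported int_point S.
Proof.
(* The certificate is a lower bound and [valid] an upper bound, hence the minus sign. *)
move=> hS; pose c : 'cV[R]_n := \col_j - (h`_j.+1)%:~R.
pose b : R := (h`_0)%:~R.
have dE w : slack c b w = (dotz h (hom w))%:~R.
  rewrite slackE /dotz.
  have -> : foldr (fun j s => h`_j * (hom w)`_j + s) 0 (iota 0 n.+1) =
      \sum_(0 <= j < n.+1) h`_j * (hom w)`_j.
    by rewrite unlock.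
  rewrite big_mkord rmorph_sum; apply: eq_bigr => j _ /=.
  rewrite rmorphM /= mulrC; congr (_ * _).
  by case: unliftP => [i ->|->] //=; rewrite mxE opprK.
exists c, b; split=> [w|].
  by rewrite -subr_ge0 -/(slack c b w) dE ler0z; case: (hS w).
apply/setP => w; rewrite inE -(hS w).2.
by rewrite -(intr_eq0 R) -dE subr_eq0 eq_sym.
Qed.

Lemma slack_comb c b (l : seq (nat * vtx)) :
  \sum_(kx <- l) kx.1%:R * slack c b kx.2 =
  \sum_(j < n.+1) (coef l j)%:~R *
    (if unlift ord0 j is Some i then - c i 0 else b).
Proof.
elim: l => [|[k x] l IHl] /=.
  by rewrite big_nil big1// => j _; rewrite mul0r.
rewrite big_cons IHl slackE big_distrr -big_split; apply: eq_bigr => j _ /=.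
by rewrite rmorphD rmorphM /= mulrDl mulrA.
Qed.

(** The weighted slacks have equal sums on both sides. The left sum is zero and the right one has
    nonnegative terms, so each of these vanishes. *)
Lemma balanced_tight (l r : seq (nat * vtx)) c b : balanced l r ->
  valid int_point c b ->
  (forall kx, kx \in l -> kx.2 \in tight int_point c b) ->
  forall kx, kx \in r -> (0 < kx.1)%N -> kx.2 \in tight int_point c b.
Proof.
move=> bal vcb lt [k x] kxr /= k0.
have s_ge0 u : 0 <= slack c b u by rewrite subr_ge0.
have tE u : (u \in tight int_point c b) = (slack c b u == 0).
  by rewrite inE subr_eq0 eq_sym.
have: \sum_(kx <- r) kx.1%:R * slack c b kx.2 = 0.
  rewrite slack_comb; transitivity (\sum_(kx <- l) kx.1%:R * slack c b kx.2).
    rewrite slack_comb; apply: eq_bigr => j _; congr (_%:~R * _).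
    move/allP: bal => /(_ (val j)); rewrite mem_iota /=.
    by move=> /(_ (ltn_ord j))/eqP.
  by rewrite big_seq big1// => kx /lt; rewrite tE => /eqP->; rewrite mulr0.
rewrite (big_rem _ kxr) /= tE => /eqP; rewrite paddr_eq0.
- by rewrite mulf_eq0 pnatr_eq0 gtn_eqF// => /andP[].
- by rewrite mulr_ge0 ?ler0n.
by apply: sumr_ge0 => kx _; rewrite mulr_ge0 ?ler0n.
Qed.

Lemma has_graph_cert facets deps :
  edges_check facets -> nonedges_check deps -> has_graph cube_adj int_point.
Proof.
move=> edges nonedges; split=> [u v uv|u v S [c [b [vcb ->]]] uS vS uv nuv].
  apply: (@supported_cert (facet_sum facets u v)) => w.
  have := all_vertices (all_vertices edges u) v.
  rewrite cube_dist_le1 uv => /all_vertices/(_ w)/andP[h0 /eqP ->].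
  by rewrite !inE.
have := all_vertices (all_vertices nonedges u) v.
rewrite cube_dist_le1 (negbTE uv) (negbTE nuv) => /hasP[lr _].
rewrite /third_vertex; case: ifP => // /allP luv.
move=> /andP[/hasP[kw kwr /andP[k0 wuv]] bal]; set w := kw.2 in wuv.
have wS : w \in tight int_point c b.
  by apply: (balanced_tight bal vcb _ kwr k0) => kx /luv /orP[]/eqP->.
move: wuv; rewrite negb_or => /andP[wu wv].
by apply/card_gt2P; exists u, v, w; rewrite uS vS wS uv wu eq_sym wv.
Qed.

Lemma far_cert cls deps (S : {set vtx}) : far_check cls deps ->
  supported int_point S -> S != [set: vtx]%SET -> (#|S| <= 8)%N.
Proof.
move=> far [c [b [vcb SE]]] ST.
suff cls_inj : {in S &, injective cls}.
  rewrite -(card_in_imset cls_inj) (leq_trans (max_card _))//.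
  by rewrite !card_prod !card_bool.
move=> u v uS vS cuv; apply: contra_neq_eq ST => uv.
apply/setP => w; rewrite SE !inE; move: uS vS; rewrite SE => uS vS.
have := all_vertices (all_vertices far u) v.
rewrite uv cuv eqxx => /hasP[lr _].
rewrite /all_positive; case: ifP => // /allP luv.
move=> /andP[/all_vertices/(_ w)/hasP[kw kwr /andP[k0 /eqP<-]] bal].
have := balanced_tight bal vcb _ kwr k0; rewrite inE; apply.
by move=> kx /luv /orP[]/eqP->.
Qed.

Lemma has_dim_cert : axes_check -> has_dim (hull int_point [set: vtx]) n.
Proof.
move=> /hasP[u _ /allP axes]; apply: (has_dim_full (x0 := int_point u)).
  by apply: hull_vertex; rewrite inE.
move=> j; have /axes/hasP[v _ /andP[vj /allP vi]] : val j \in iota 0 n.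
  by rewrite mem_iota add0n ltn_ord.
exists (((p v)`_j - (p u)`_j)%:~R); first by rewrite intr_eq0 subr_eq0.
suff -> : int_point u + ((p v)`_j - (p u)`_j)%:~R *: delta_mx 0 j = int_point v.
  by apply: hull_vertex; rewrite inE.
apply/rowP => i; rewrite !mxE /= rmorphB /=.
have [->|ij] := eqVneq i j; first by rewrite mulr1 subrKC.
have := vi i; rewrite mem_iota add0n ltn_ord.
rewrite -[(i == j :> nat)]/(i == j) (negbTE ij).
by move=> /(_ isT)/eqP->; rewrite mulr0 addr0.
Qed.

Lemma dpolytope_cert : axes_check -> dpolytope n (hull int_point [set: vtx]).
Proof.
move=> axes; split; last exact: has_dim_cert.
exists (int_point @` [set` [set: vtx]%SET]) => //.
exact: finite_image.
Qed.

End Certificates.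

(** * The cube and the two 4-polytopes *)

Definition flip (i : nat) (u : vtx) : vtx :=
  let: (a, b, c, d, e) := u in
  (a (+) (i == 0%N), b (+) (i == 1%N), c (+) (i == 2), d (+) (i == 3),
   e (+) (i == 4)).

(* If the edges of u and v in direction i are parallel, with lengths
   proportional to [len i u] and [len i v], then u and v get opposite
   displacements when the bit i, in which they differ, is flipped in both;
   hence len i v * u + len i u * v does not change. *)
Definition flip_deps (len : nat -> vtx -> nat) (u v : vtx) :
    seq (seq (nat * vtx) * seq (nat * vtx)) :=
  [seq ([:: (len i v, u); (len i u, v)],
        [:: (len i v, flip i u); (len i u, flip i v)]) | i <- iota 0 5].

Definition sgb (a : bool) : int := if a then -1 else 1.

Definition p_cube (u : vtx) : seq int :=
  let: (a, b, c, d, e) := u in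
  [seq (nat_of_bool x)%:Z | x <- [:: a; b; c; d; e]].

Definition cube_facets : seq (seq int) :=
  [:: [:: 0; 1; 0; 0; 0; 0]; [:: 0; 0; 1; 0; 0; 0]; [:: 0; 0; 0; 1; 0; 0];
      [:: 0; 0; 0; 0; 1; 0]; [:: 0; 0; 0; 0; 0; 1];
      [:: 1; -1; 0; 0; 0; 0]; [:: 1; 0; -1; 0; 0; 0]; [:: 1; 0; 0; -1; 0; 0];
      [:: 1; 0; 0; 0; -1; 0]; [:: 1; 0; 0; 0; 0; -1]].

Definition p_cubical (u : vtx) : seq int :=
  let: (a, b, c, d, e) := u in
  let s := if e then 1 else 2 in let t := if e then 2 else 1 in
  [:: s * sgb a; s * sgb b; t * sgb c; t * sgb d].

Definition signs : seq int := [:: 1; -1].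

Definition cubical_facets : seq (seq int) :=
  flatten [seq [:: [:: 2; s; 0; 0; 0]; [:: 2; 0; s; 0; 0]; [:: 2; 0; 0; s; 0];
                   [:: 2; 0; 0; 0; s]] | s <- signs] ++
  flatten [seq [:: [:: 3; s; 0; t; 0]; [:: 3; s; 0; 0; t]; [:: 3; 0; s; t; 0];
                   [:: 3; 0; s; 0; t]] | s <- signs, t <- signs].

(* All four points with given (a, b, e) have |x3| = |x4| = t.  The extra vertex
   on the hypotenuse of the triangle is (6, 6). *)
Definition p_merged (u : vtx) : seq int :=
  let: (a, b, c, d, e) := u in
  let: (x, y, t) := match a, b, e with
    | false, false, false => (0, 0, 2)
    | true, false, false => (12, 0, 2)
    | false, true, false => (0, 12, 2)
    | true, true, false => (6, 6, 3)
    | false, false, true => (2, 2, 4)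
    | true, false, true => (5, 2, 4)
    | false, true, true => (2, 5, 4)
    | true, true, true => (4, 4, 4)
    end in
  [:: x; y; t * sgb c; t * sgb d].

(** One inequality fewer than in [cubical_facets]: the merged facet is [[:: 12; -1; -1; 0; 0]]. *)
Definition merged_facets : seq (seq int) :=
  [:: [:: 0; 1; 0; 0; 0]; [:: 0; 0; 1; 0; 0]; [:: 12; -1; -1; 0; 0]] ++
  flatten [seq [:: [:: 4; 0; 0; s; 0]; [:: 4; 0; 0; 0; s];
                   [:: 36; -2; -1; 6 * s; 0]; [:: 36; -2; -1; 0; 6 * s];
                   [:: 36; -1; -2; 6 * s; 0]; [:: 36; -1; -2; 0; 6 * s];
                   [:: 2; 1; 0; s; 0]; [:: 2; 1; 0; 0; s];
                   [:: 2; 0; 1; s; 0]; [:: 2; 0; 1; 0; s]] | s <- signs].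

(* The dependences that flip_deps misses, found by a computer search; they
   concern pairs of vertices with the same bits c and d. *)
Definition merged_deps : seq (seq (nat * vtx) * seq (nat * vtx)) :=
  flatten [seq
    let V (a b e : nat) : vtx := (a == 1, b == 1, cd.1, cd.2, e == 1)%N in
    let opp (a b e : nat) : vtx :=
      (a == 1, b == 1, ~~ cd.1, ~~ cd.2, e == 1)%N in
    [:: ([:: (2, V 0 0 0); (2, V 1 1 0)], [:: (1, opp 0 0 0); (3, V 1 1 1)]);
        ([:: (3, V 0 0 0); (2, V 1 1 1)], [:: (4, V 0 0 1); (1, opp 0 0 0)]);
        ([:: (4, V 0 0 1); (2, V 1 1 0)], [:: (1, V 0 0 0); (5, V 1 1 1)]);
        ([:: (1, V 0 0 1); (3, V 1 1 1)], [:: (2, V 0 1 1); (2, V 1 0 1)]);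
        ([:: (3, V 0 1 0); (2, V 1 0 0)], [:: (1, opp 0 1 0); (4, V 1 1 0)]);
        ([:: (1, V 0 1 0); (4, V 1 0 1)], [:: (4, V 0 1 1); (1, V 1 0 0)]);
        ([:: (1, V 0 1 0); (5, V 1 1 1)], [:: (4, V 0 1 1); (2, V 1 1 0)]);
        ([:: (4, V 0 1 1); (1, V 1 0 0)], [:: (1, V 0 1 0); (4, V 1 0 1)]);
        ([:: (2, V 0 1 1); (2, V 1 0 1)], [:: (1, V 0 0 1); (3, V 1 1 1)]);
        ([:: (4, V 0 1 1); (2, V 1 1 0)], [:: (1, V 0 1 0); (5, V 1 1 1)]);
        ([:: (1, V 1 0 0); (5, V 1 1 1)], [:: (4, V 1 0 1); (2, V 1 1 0)]);
        ([:: (4, V 1 0 1); (2, V 1 1 0)], [:: (1, V 1 0 0); (5, V 1 1 1)])]%N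
  | cd <- [seq (c, d) | c <- [:: false; true], d <- [:: false; true]]].

(** The four points of a class are the corners of a square with centre 0: they are ±(2p, q) and ±(p,
    -2q) for sign vectors p and q in the plane. *)
Definition cubical_class (u : vtx) : bool * bool * bool :=
  let: (a, b, c, d, e) := u in (a (+) b, c (+) d, a (+) c (+) e).

(* The relations u + v = 0 and 3u + 4v = 5w; as all vertices add up to 0, their
   sum can be added to the right-hand sides. *)
Definition cubical_far (u v : vtx) : seq (seq (nat * vtx) * seq (nat * vtx)) :=
  let all1 := [seq (1, w) | w <- vertices]%N in
  ([:: (16, u); (16, v)], all1)%N ::
  [seq ([:: (48, xy.1); (64, xy.2)], (80, flip i (flip i.+1 xy.1)) :: all1)%N
    | xy <- [:: (u, v); (v, u)], i <- [:: 0; 2]%N].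

Definition cube_len (i : nat) (u : vtx) : nat := 1.

Definition cubical_len (i : nat) (u : vtx) : nat :=
  if (i < 2)%N (+) u.2 then 2 else 1.

(** The ratio 4 to 1 is that of the axis-parallel sides, 12 and 3, in the first two coordinates; the
    last branch gives half the edge lengths in directions 2 and 3. *)
Definition merged_len (i : nat) (u : vtx) : nat :=
  let: (a, b, c, d, e) := u in
  if (i < 2)%N then (if e then 1 else 4)
  else (if e then 4 else if a && b then 3 else 2).

Section Polytopes5.
Context {R : realType}.

Lemma cube_hull : hull (@int_point 5 p_cube R) [set: vtx] = cube R 5.
Proof.
have pE (f : nat -> bool) (j : 'I_5) :
    (p_cube (f 0, f 1, f 2, f 3, f 4)%N)`_j = (f j : nat)%:Z.
  have -> : p_cube (f 0, f 1, f 2, f 3, f 4)%N =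
    mkseq (fun i => (f i : nat)%:Z) 5 by [].
  by rewrite nth_mkseq.
apply/seteqP; split.
  apply: smallest_sub.
    apply/convex_setP => x y t /andP[t0 t1] xC yC i; rewrite !mxE.
    by have /andP[? ?] := xC i; have /andP[? ?] := yC i; apply/andP; split; nra.
  move=> _ [[[[[a b] c] d] e] _ <-] i; rewrite mxE.
  rewrite (pE (nth false [:: a; b; c; d; e])).
  by case: (nth _ _ _); rewrite ?lexx ler01.
(* Induction on the number of coordinates not yet known to be 0 or 1: [x] lies on the segment
   between the points with coordinate [k] replaced by 0 and by 1. *)
suff H k x : (k <= 5)%N -> cube R 5 x ->
    (forall j : 'I_5, (k <= j)%N -> x 0 j = 0 \/ x 0 j = 1) ->
    hull (@int_point 5 p_cube R) [set: vtx] x.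
  by move=> x xC; apply: (H 5%N) => // j; rewrite leqNgt ltn_ord.
elim: k x => [|k IHk] x k5 xC x01.
  suff -> : x = int_point 5 p_cube (x 0 (inord 0) == 1, x 0 (inord 1) == 1,
      x 0 (inord 2) == 1, x 0 (inord 3) == 1, x 0 (inord 4) == 1).
    by apply: hull_vertex; rewrite inE.
  apply/rowP => j; rewrite mxE (pE (fun i => x 0 (inord i) == 1)) inord_val.
  by case: (x01 j) => // ->; rewrite ?eqxx // eq_sym oner_eq0.
pose j0 := Ordinal k5.
pose y (t : R) : 'rV[R]_5 := \row_j (if j == j0 then t else x 0 j).
have yhull t : t = 0 \/ t = 1 -> hull (@int_point 5 p_cube R) [set: vtx] (y t).
  move=> t01; apply: IHk => [|j|j kj]; first exact: ltnW.
    rewrite mxE; case: ifP => // _; case: t01 => ->; rewrite ?lexx ?ler01 //.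
  rewrite mxE; case: eqVneq => // jj0; apply: x01.
  by rewrite ltn_neqAle kj andbT eq_sym.
have -> : x = x 0 j0 *: y 1 + (1 - x 0 j0) *: y 0.
  apply/rowP => j; rewrite !mxE; case: eqP => [->|_].
    by rewrite mulr1 mulr0 addr0.
  by rewrite -mulrDl addrC subrK mul1r.
have /convex_setP :=
  @convex_conv_hull R 5 (@int_point 5 p_cube R @` [set` [set: vtx]%SET]).
by apply; [exact: xC|apply: yhull; right|apply: yhull; left].
Qed.

Lemma has_graph_cube : has_graph cube_adj (@int_point 5 p_cube R).
Proof.
by apply: (has_graph_cert (facets := cube_facets)
  (deps := flip_deps cube_len)); vm_compute.
Qed.

Lemma has_graph_cubical : has_graph cube_adj (@int_point 4 p_cubical R).
Proof.
by apply: (has_graph_cert (facets := cubical_facets)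
  (deps := flip_deps cubical_len)); vm_compute.
Qed.

Lemma has_graph_merged : has_graph cube_adj (@int_point 4 p_merged R).
Proof.
by apply: (has_graph_cert (facets := merged_facets)
  (deps := fun u v => flip_deps merged_len u v ++ merged_deps)); vm_compute.
Qed.

Lemma cubical_face_card (S : {set vtx}) :
  supported (@int_point 4 p_cubical R) S -> S != [set: vtx]%SET ->
  (#|S| <= 8)%N.
Proof.
by apply: (far_cert (cls := cubical_class) (deps := cubical_far)); vm_compute.
Qed.

(** The 12 vertices over the hypotenuse and its extra vertex, where the first two coordinates add up
    to 12. *)
Definition merged_face : seq vtx :=
  [seq u <- vertices | let: (a, b, c, d, e) := u in (a || b) && ~~ e].

Lemma supported_merged_face :
  supported (@int_point 4 p_merged R) [set:: merged_face]%SET.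
Proof.
apply: (@supported_cert 4 p_merged R [:: 12; -1; -1; 0; 0]).
by move=> u; rewrite inE; move: u => [[[[[] []] []] []] []].
Qed.

(** The proper face with 12 vertices would yield a proper face with at least 12 vertices in a
    polytope whose proper faces have at most 8. *)
Lemma not_comb_equiv_merged_cubical :
  ~ comb_equiv (faces (hull (@int_point 4 p_merged R) [set: vtx]))
               (faces (hull (@int_point 4 p_cubical R) [set: vtx])).
Proof.
move=> /(comb_equiv_proper_face (has_graph_vertex has_graph_merged)
          (has_graph_vertex has_graph_cubical)) /(_ supported_merged_face).
have c12 : #|[set:: merged_face]%SET| = 12%N by rewrite cardsE; apply/card_uniqP.
case=> [|S [/cubical_face_card S8 /S8 {}S8 /leq_trans/(_ S8)]]; last first.
  by rewrite c12.
apply/eqP => /(congr1 (fun A : {set vtx} => #|A|)).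
by rewrite c12 cardsT !card_prod !card_bool.
Qed.

End Polytopes5.

Theorem mainTheorem5 (R : realType) :
  strongly_ambiguous 1 4 (skeleton 1 (cube R 5)).
Proof.
exists 5%N, 5%N, 4%N, 4%N, (cube R 5), (hull (int_point 4 p_merged) [set: vtx]),
  (hull (int_point 4 p_cubical) [set: vtx]).
split; split=> //.
- by rewrite -cube_hull; apply: dpolytope_cert; vm_compute.
- by apply: dpolytope_cert; vm_compute.
- by apply: dpolytope_cert; vm_compute.
- by exists id; split=> //; split=> // F SF; exists F.
- rewrite -cube_hull.
  exact: comb_equiv_skeleton1 has_graph_merged has_graph_cube.
- rewrite -cube_hull.
  exact: comb_equiv_skeleton1 has_graph_cubical has_graph_cube.
exact: not_comb_equiv_merged_cubical.
Qed.
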